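(* There are no $(7,2;+1)$-digraphs; that is, there is no $2$-geodetic digraph with minimum out-degree $7$ and order $1+7+7^2+1=58$.
   Context: Digraphs are finite and without multiple arcs. A digraph $G$ is $k$-geodetic if for any (not necessarily distinct) vertices $u,v$ there is at most one directed walk from $u$ to $v$ of length at most $k$ (walks of length $0$ count, so there are no directed cycles of length at most $k$). A $(d,k;+1)$-digraph is a $k$-geodetic digraph with minimum out-degree $d$ and order $M(d,k)+1$, where $M(d,k)=1+d+d^2+\dots+d^k$. It is known that every $(d,k;+1)$-digraph with $d,k\ge 2$ is diregular (all in-degrees and out-degrees equal $d$). *)

(* Defs.v *)
From mathcomp Require Import all_boot.

Set Implicit Arguments.
Unset Strict Implicit.
Unset Printing Implicit Defensive.

(* A digraph is a finite vertex type T with an arc relation e : rel T, which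
   rules out multiple arcs.  Loops are not excluded here; they are
   excluded by k-geodecity for k >= 1. *)

Definition outdeg (T : finType) (e : rel T) (u : T) : nat := #|[set v | e u v]|.

Definition min_outdeg_is (T : finType) (e : rel T) (d : nat) : Prop :=
  (forall u : T, d <= outdeg e u) /\ (exists u : T, outdeg e u = d).

(* The directed walk u = x_0, x_1, ..., x_l = v is encoded by its tail
   p = [:: x_1; ...; x_l], so its length is size p and [::] is the walk of
   length 0 from u to u. *)
Definition walk (T : finType) (e : rel T) (u v : T) (p : seq T) : Prop :=
  path e u p /\ last u p = v.

Definition k_geodetic (T : finType) (e : rel T) (k : nat) : Prop :=
  forall (u v : T) (p q : seq T),
    walk e u v p -> size p <= k -> walk e u v q -> size q <= k -> p = q.

Definition moore_bound (d k : nat) : nat := \sum_(0 <= i < k.+1) d ^ i.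

(* (d, k; +1)-digraphs *)
Definition excess_one_digraph (d k : nat) (T : finType) (e : rel T) : Prop :=
  [/\ k_geodetic e k, min_outdeg_is e d & #|T| = moore_bound d k + 1].

(* Main.v *)
Require Import Defs.
From Stdlib Require Import ZArith.
From mathcomp Require Import all_boot all_order all_algebra all_fingroup.
From mathcomp Require Import all_solvable all_field.
From mathcomp Require Import ssrZ zify ring.

Set Implicit Arguments.
Unset Strict Implicit.
Unset Printing Implicit Defensive.

Import Order.TTheory GRing.Theory Num.Theory.

(** Counting walks of length at most 2 shows that all out-degrees are 7 and that
    every vertex u fails to reach exactly one vertex, its outlier o(u).  If A is
    the adjacency matrix and P the matrix of o, then A^2 + A + 1 + P = J.

    Suppose all in-degrees are 7.  Then o is a permutation commuting with A, and
    B = 2A + 1 satisfies B^2 = 4J - 3 - 4P.  On the eigenspace of P for a root of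
    unity z <> 1, the square of B is the scalar -3 - 4z, so the trace of B there is
    an integer multiple of a square root of -3 - 4z; this trace is g(z)/L, where L
    is a multiple of the order of o and g = sum_(j<L) c_j X^j with
    c_j = tr(B P^-j) >= 0.  Taking the norm from Q(z) to Q, g(z) <> 0 would make the
    norm of -3 - 4z a square, which fails for every order of z up to 58 except 2
    and 4.  So g vanishes at all L-th roots of unity but the fourth ones, i.e. c_j
    depends only on j mod 4.  Now c_0 = tr B = 58 and the average of c is 15, so
    c_1 + c_2 + c_3 = 2, while z = i gives (c_0 - c_2)^2 <= (c_1 - c_3)^2:
    a contradiction.

    If some in-degree is not 7, merging a vertex of small in-degree into its
    outlier yields a Moore digraph with 57 vertices, which is excluded by the
    trace of its own 2A + 1. *)

(** * Outliers *)

Lemma eq_from_leq_sum (I : finType) (F G : I -> nat) :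
  (forall i, F i <= G i) -> \sum_i G i <= \sum_i F i -> F =1 G.
Proof.
move=> FG sGF i; apply/eqP; rewrite eqn_leq FG /=.
move: sGF; rewrite (bigD1 i) //= [leqRHS](bigD1 i) //= => sGF.
have : \sum_(j | j != i) F j <= \sum_(j | j != i) G j by apply: leq_sum => j _.
lia.
Qed.

Lemma sum_mul_eq (I : finType) (F : I -> nat) a : \sum_i (i == a) * F i = F a.
Proof.
rewrite (bigD1 a) //= eqxx mul1n big1 ?addn0 // => i /negPf->.
by rewrite mul0n.
Qed.

Lemma sum_eq1 (I : finType) (a : I) : \sum_i (i == a) = 1.
Proof. by rewrite -[RHS](sum_mul_eq (fun=> 1) a); apply: eq_bigr => i _; rewrite muln1. Qed.

Definition walks2 (T : finType) (e : rel T) (u v : T) := \sum_w e u w * e w v.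

Definition reach2 (T : finType) (e : rel T) (u v : T) := (u == v) + e u v + walks2 e u v.

Lemma outdegE (T : finType) (e : rel T) u : outdeg e u = \sum_v e u v.
Proof. by rewrite /outdeg -sum1dep_card big_mkcond; apply: eq_bigr => v _; case: ifP. Qed.

(** Two positive terms, or two middle vertices in [walks2], would give two distinct walks from u to
    v of length at most 2. *)
Lemma reach2_le1 (T : finType) (e : rel T) u v : k_geodetic e 2 -> reach2 e u v <= 1.
Proof.
move=> geo; rewrite /reach2 /walks2.
have geoN p q : walk e u v p -> walk e u v q -> size p <= 2 -> size q <= 2 -> p = q.
  by move=> wp wq sp sq; exact: geo sp wq sq.
have walk0 : u == v -> walk e u v [::] by move/eqP.
have walk1 : e u v -> walk e u v [:: v] by move=> uv; split; rewrite //= uv.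
have walk2 w : e u w && e w v -> walk e u v [:: w; v].
  by move=> /andP[uw wv]; split; rewrite //= uw wv.
have [w0 w0P | none] := pickP (fun w => e u w && e w v); last first.
  rewrite big1 => [|w _]; last by rewrite mulnb none.
  rewrite addn0; case: eqP => [/eqP uv|_]; last by rewrite leq_b1.
  by case: (boolP (e u v)) => // /walk1 w1; have := geoN _ _ (walk0 uv) w1 isT isT.
have -> : \sum_w e u w * e w v = 1.
  rewrite -(sum_eq1 w0); apply: eq_bigr => w _; rewrite mulnb; congr nat_of_bool.
  apply/idP/eqP => [wP|-> //].
  by have [] := geoN _ _ (walk2 _ wP) (walk2 _ w0P) isT isT.
case: eqP => [/eqP uv|_]; first by have := geoN _ _ (walk0 uv) (walk2 _ w0P) isT isT.
by case: (boolP (e u v)) => // /walk1 w1; have := geoN _ _ w1 (walk2 _ w0P) isT isT.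
Qed.

Lemma sum_reach2 (T : finType) (e : rel T) u :
  \sum_v reach2 e u v = 1 + outdeg e u + \sum_w e u w * outdeg e w.
Proof.
rewrite /reach2 !big_split /= -(outdegE e u); congr (_ + _ + _).
  by under eq_bigr => v _ do rewrite eq_sym; rewrite sum_eq1.
rewrite exchange_big /=; apply: eq_bigr => w _.
by rewrite -big_distrr /= -outdegE.
Qed.

Definition outlier_system (T : finType) (e : rel T) (o : T -> T) :=
  (forall u, \sum_v e u v = 7) /\ (forall u v, reach2 e u v + (v == o u) = 1).

(** If u has out-degree d, its row of [reach2] sums to at least 1 + d + 7d and at most 58, so d = 7.
    The sum is then 1 + 7 + 49 = 57, and exactly one of the 58 entries, all at most 1, vanishes. *)
Lemma exists_outlier (T : finType) (e : rel T) :
    k_geodetic e 2 -> (forall u, 7 <= outdeg e u) -> #|T| = 58 ->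
  exists o : T -> T, outlier_system e o.
Proof.
move=> geo deg card.
have le1 u v := reach2_le1 u v geo.
have s1 : \sum_(v : T) 1 = 58 by rewrite sum1_card card.
have sum_le u : \sum_v reach2 e u v <= 58.
  by rewrite -s1; apply: leq_sum => v _.
have deg7 u : outdeg e u = 7.
  have := sum_le u; rewrite sum_reach2.
  have : outdeg e u * 7 <= \sum_w e u w * outdeg e w.
    by rewrite outdegE big_distrl; apply: leq_sum => w _; rewrite leq_mul2l deg orbT.
  by move: (deg u); lia.
have sum57 u : \sum_v reach2 e u v = 57.
  rewrite sum_reach2 deg7; under eq_bigr => w _ do rewrite deg7.
  by rewrite -big_distrl /= -outdegE deg7.
have outb u : exists v, [forall x, reach2 e u x + (x == v) == 1].
  have [v v0 | all1] := pickP (fun v => reach2 e u v == 0); last first.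
    have : \sum_(v : T) 1 <= \sum_v reach2 e u v.
      by apply: leq_sum => v _; rewrite lt0n all1.
    by rewrite s1 sum57.
  exists v; apply/forallP => x; apply/eqP; move: x.
  apply: (eq_from_leq_sum (F := fun x => reach2 e u x + (x == v)) (G := fun=> 1)) => [x|].
    by have [->|_] := eqVneq x v; rewrite ?(eqP v0) // addn0.
  by rewrite big_split /= sum57 sum_eq1 s1.
exists (fun u => xchoose (outb u)); split=> [u|u v]; first by rewrite -outdegE.
by have /forallP/(_ v)/eqP := xchooseP (outb u).
Qed.

(** * In-degrees *)

Definition indeg (T : finType) (e : rel T) (v : T) := \sum_u e u v.

(** Entry (u, v) of A P. *)
Definition out_outliers (T : finType) (e : rel T) (o : T -> T) (u v : T) :=
  \sum_w e u w * (v == o w).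

(** The term [u == u] already exhausts the total 1 of entry (u, u). *)
Lemma outlier_simple (T : finType) (e : rel T) (o : T -> T) u :
  outlier_system e o -> [/\ ~~ e u u, o u != u & forall w, e u w -> ~~ e w u].
Proof.
case=> _ /(_ u u); rewrite /reach2 eqxx => H.
split; first by case: (e u u) H.
  by rewrite eq_sym; case: (u == o u) H => //; lia.
move=> w uw; apply/negP => wu; have : walks2 e u u = 0 by lia.
by rewrite /walks2 (bigD1 w) //= uw wu.
Qed.

(** The entry (u, v) of A (A^2 + A + 1) = (A^2 + A + 1) A. *)
Lemma out_outliers_indeg (T : finType) (e : rel T) (o : T -> T) u v : outlier_system e o ->
  out_outliers e o u v + indeg e v = 7 + e (o u) v.
Proof.
case=> deg H.
have e1 : \sum_w e u w * (reach2 e w v + (v == o w)) = 7.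
  by under eq_bigr => w _ do rewrite H muln1; exact: deg.
have e2 : \sum_w (reach2 e u w + (w == o u)) * e w v = indeg e v.
  by apply: eq_bigr => w _; rewrite H mul1n.
have l1 : \sum_w e u w * (w == v) = e u v.
  by under eq_bigr => w _ do rewrite mulnC; rewrite sum_mul_eq.
have l2 : \sum_w (u == w) * e w v = e u v.
  by under eq_bigr => w _ do rewrite eq_sym; rewrite sum_mul_eq.
have l3 : \sum_w (w == o u) * e w v = e (o u) v by rewrite sum_mul_eq.
have l4 : \sum_w e u w * walks2 e w v = \sum_w walks2 e u w * e w v.
  under eq_bigr => w _ do rewrite big_distrr /=.
  under [RHS]eq_bigr => w _ do rewrite big_distrl /=.
  rewrite exchange_big /=; apply: eq_bigr => w _; apply: eq_bigr => x _.
  by rewrite mulnA.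
move: e1 e2; rewrite /reach2.
under eq_bigr => w _ do rewrite !mulnDr.
rewrite !big_split /= => e1.
under eq_bigr => w _ do rewrite !mulnDl.
rewrite !big_split /= => e2.
rewrite /out_outliers; move: e1 e2.
rewrite l1 l2 l3 l4 -!/(walks2 _ _ _); lia.
Qed.

Lemma sum_indeg (T : finType) (e : rel T) (o : T -> T) : outlier_system e o ->
  \sum_v indeg e v = 7 * #|T|.
Proof.
case=> deg _; rewrite exchange_big /=.
by under eq_bigr => u _ do rewrite deg; rewrite sum_nat_const mulnC.
Qed.

(** Column v of A^2 + A + 1 + P = J, summed. *)
Lemma indeg_count (T : finType) (e : rel T) (o : T -> T) v : outlier_system e o ->
  1 + indeg e v + \sum_w indeg e w * e w v + \sum_u (v == o u) = #|T|.
Proof.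
case=> _ H; rewrite -sum1_card -(eq_bigr _ (fun u _ => H u v)) /reach2 !big_split /= sum_eq1.
congr (_ + _ + _ + _); rewrite /walks2 exchange_big /=.
by apply: eq_bigr => w _; rewrite big_distrl.
Qed.

(** In-degrees are at most 8.  If they are not all 7, counting around a vertex of
    in-degree 8 shows that the deficits 7 - indeg sum to exactly 7, that there are
    7 vertices of in-degree 8, and that these are the out-neighbours of every
    vertex of positive deficit.  If z and s are two such vertices, then s = o z:
    otherwise z reaches s through some x, which is also an out-neighbour of s, so
    that s lies on a 2-cycle. *)
Lemma indeg_dichotomy (T : finType) (e : rel T) (o : T -> T) :
    outlier_system e o -> #|T| = 58 ->
  (forall v, indeg e v = 7) \/
  (exists z, (forall u, u != z -> o u = z \/ o u = o z) /\
             ((forall u, ~~ e u z) \/ (forall v, e (o z) v = e z v))).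
Proof.
move=> sys card; have R2 u v := out_outliers_indeg u v sys.
have R3 v := indeg_count v sys; have := sum_indeg sys.
rewrite card => sumd; have [deg H] := sys.
case: (boolP [forall v, indeg e v == 7]) => [/forallP d7|nd7]; first by left=> v; exact/eqP.
right; pose defi v := 7 - indeg e v; pose S8 v := indeg e v == 8.
have le8 v : indeg e v <= 8 by have := R2 v v; lia.
have defiE v : indeg e v + defi v = 7 + S8 v.
  by rewrite /defi /S8; have := le8 v; case: eqP; lia.
have sum_defi : \sum_v defi v = \sum_v S8 v.
  apply: (@addnI (\sum_v indeg e v)); rewrite -big_split /= {1}sumd.
  by under eq_bigr => v _ do rewrite defiE; rewrite big_split /= sum_nat_const card mulnC.
have [v' v'8] : exists v', indeg e v' = 8.
  have [v' /eqP v'8|no8] := pickP S8; first by exists v'.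
  case/forallPn: nd7 => v; rewrite (_ : indeg e v == 7) //.
  have : defi v = 0.
    apply/eqP; have : \sum_v defi v == 0 by rewrite sum_defi big1 // => x _; rewrite no8.
    by rewrite sum_nat_eq0 => /forallP/(_ v).
  by have := defiE v; rewrite no8 => h d0; apply/eqP; lia.
have u0 : T := v'.
have Xsum u : \sum_v out_outliers e o u v = 7.
  rewrite exchange_big /= -(deg u); apply: eq_bigr => w _.
  by rewrite -big_distrr /= sum_eq1 muln1.
have defi_le u v : defi v <= out_outliers e o u v by have := R2 u v; rewrite /defi; lia.
have sum_defi_le7 : \sum_v defi v <= 7 by rewrite -(Xsum u0); apply: leq_sum => v _.
(* The in-degrees of the 8 in-neighbours of v sum to at most 58 - 1 - 8 = 49, which is at least 7
   short of 8 times 7. *)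
have defi_in v : indeg e v = 8 -> 7 <= \sum_w defi w * e w v.
  move=> v8; have := R3 v; rewrite card v8.
  have : \sum_w 7 * e w v <= \sum_w (indeg e w * e w v + defi w * e w v).
    by apply: leq_sum => w _; rewrite -mulnDl leq_mul2r defiE leq_addr orbT.
  rewrite -big_distrr /= -/(indeg e v) v8 big_split /=; lia.
have in_le v : \sum_w defi w * e w v <= \sum_w defi w.
  by apply: leq_sum => w _; case: (e w v); rewrite ?muln1 ?muln0.
have sum_defi7 : \sum_v defi v = 7.
  by have := defi_in _ v'8; have := in_le v'; lia.
(* Both sides sum to 7 over v, so [defi_le] is an equality for every u. *)
have XE u v : defi v = out_outliers e o u v.
  by apply: eq_from_leq_sum => [x|]; rewrite ?defi_le // Xsum sum_defi7.
have out_defi u w : e u w -> 0 < defi (o w).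
  by move=> uw; rewrite (XE u) /out_outliers (bigD1 w) //= uw eqxx.
have defi_arc w v : 0 < defi w -> S8 v -> e w v.
  move=> w0 /eqP v8.
  have : defi w * e w v = defi w.
    apply: (eq_from_leq_sum (F := fun w => defi w * e w v) (G := defi)) => [x|].
      by case: (e x v); rewrite ?muln1 ?muln0.
    by rewrite sum_defi7; exact: defi_in.
  by case: (e w v) => //; lia.
have sum_S8 : \sum_v S8 v = 7 by rewrite -sum_defi.
have defi_out w v : 0 < defi w -> e w v = S8 v.
  move=> w0; apply/esym; have : nat_of_bool (S8 v) = e w v.
    apply: (eq_from_leq_sum (F := fun v => nat_of_bool (S8 v))
                            (G := fun v => nat_of_bool (e w v))) => [x|]; last first.
      by rewrite deg sum_S8.
    by case: (boolP (S8 x)) => // /(defi_arc _ _ w0) ->.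
  by case: (S8 v) (e w v) => [] [].
have [z z0] : exists z, 0 < defi z.
  have [z z0|no] := pickP (fun z => 0 < defi z); first by exists z.
  by move: sum_defi7; rewrite big1 // => i _; apply/eqP; rewrite -leqn0 leqNgt no.
have defi_S8 s : 0 < defi s -> S8 s = false by rewrite /defi /S8; case: eqP => // ->.
have defi_two s : 0 < defi s -> s = z \/ s = o z.
  move=> s0; have [-> | sz] := eqVneq s z; first by left.
  have [-> | soz] := eqVneq s (o z); [by right | exfalso].
  have := H z s; rewrite (negPf soz) /reach2 eq_sym (negPf sz) (defi_out z s z0) (defi_S8 s s0).
  rewrite /walks2 big1 // => x _; apply/eqP; rewrite mulnb eqb0; apply/negP => /andP[zx xs].
  have sx : e s x by rewrite (defi_out s x s0) -(defi_out z x z0).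
  by have [_ _ /(_ x sx)] := outlier_simple s sys; rewrite xs.
exists z; split=> [u uz|].
  have [w wu | none] := pickP (fun w => e w u).
    by apply: defi_two; exact: out_defi wu.
  (* A vertex without in-neighbours has deficit 7, the whole total, and leaves nothing for z. *)
  have du : indeg e u = 0 by rewrite /indeg big1 // => w _; rewrite none.
  have : defi u + defi z <= 7.
    by rewrite -sum_defi7 (bigD1 u) //= (bigD1 z) 1?eq_sym //= addnA leq_addr.
  by rewrite {1}/defi du; lia.
(* If z has an in-neighbour, then [o z] has positive deficit too, and the out-neighbours of both are
   the vertices of in-degree 8. *)
have [u uz | none] := pickP (fun u => e u z); last by left=> u; rewrite none.
by right=> v; rewrite !defi_out //; exact: out_defi uz.
Qed.

(** The arcs of the digraph obtained by deleting z and redirecting to y the arcs into z. *)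
Definition merged_arc n (e : rel 'I_n.+1) (z y : 'I_n.+1) (i j : 'I_n) : nat :=
  e (lift z i) (lift z j) + (lift z j == y) * e (lift z i) z.

Lemma sum_lift n (z : 'I_n.+1) (F : 'I_n.+1 -> nat) :
  \sum_(i < n.+1) F i = F z + \sum_(i < n) F (lift z i).
Proof. exact: bigD1_ord. Qed.

(** Put y = [o z]. Every u <> z misses exactly one of y and z, so it reaches the merged vertex
    exactly once, and every other vertex once. The last hypothesis makes a redirected arc continue
    as the original one did. *)
Lemma merged_moore n (e : rel 'I_n.+1) (o : 'I_n.+1 -> 'I_n.+1) z :
    outlier_system e o -> (forall u, u != z -> o u = z \/ o u = o z) ->
    (forall u, ~~ e u z) \/ (forall v, e (o z) v = e z v) ->
  let a := merged_arc e z (o z) in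
  (forall i, \sum_j a i j = 7) /\
  (forall i j, \sum_k a i k * a k j + a i j + (i == j) = 1).
Proof.
move=> sys out src a; have [deg H] := sys.
have [zz yz _] := outlier_simple z sys; set y := o z in yz out src a *.
have [y' y'E] : exists y', y = lift z y'.
  by case: (unliftP z y) yz => [y' ->|->]; [exists y' | rewrite eqxx].
have lz i : lift z i != z by rewrite eq_sym neq_lift.
split=> [i|i j].
  rewrite /a /merged_arc big_split /= -(deg (lift z i)) (sum_lift z) addnC; congr (_ + _).
  rewrite -big_distrl /= (eq_bigr (fun j => nat_of_bool (j == y'))) => [|j _].
    by rewrite sum_eq1 mul1n.
  by rewrite y'E (inj_eq lift_inj).
set u := lift z i; set v := lift z j.
pose f k := e k v + (v == y) * e k z.
have uz : u != z by exact: lz.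
have e_sum : \sum_k a i k * a k j = walks2 e u v + (v == y) * walks2 e u z.
  have -> : walks2 e u v + (v == y) * walks2 e u z = \sum_k e u k * f k.
    rewrite /walks2 big_distrr /= -big_split /=; apply: eq_bigr => k _.
    by rewrite /f; ring.
  rewrite (sum_lift z) /a /merged_arc -/u.
  under eq_bigr => k _ do rewrite -/(f (lift z k)) mulnDl.
  rewrite big_split /= addnC; congr (_ + _).
  rewrite (eq_bigr (fun k => (k == y') * (e u z * f y))) => [|k _].
    rewrite sum_mul_eq; case: src => [nz|yE]; first by rewrite (negPf (nz u)).
    by rewrite /f !yE.
  rewrite {1}y'E (inj_eq lift_inj); case: eqP => [->|_]; last by rewrite !mul0n.
  by rewrite -y'E !mul1n.
have ij : (i == j) = (u == v) by rewrite (inj_eq lift_inj).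
rewrite e_sum ij /a /merged_arc -/u -/v.
have := H u v; have := H u z; rewrite /reach2 (negPf uz).
have vz : v != z by exact: lz.
have zy : (z == y) = false by rewrite eq_sym (negPf yz).
clear e_sum; have [vy | vy] := eqVneq v y.
  rewrite vy; case: (out u uz) => ->; rewrite eqxx ?zy ?(negPf yz) ?mul1n;
    move: (walks2 e u y) (walks2 e u z) (e u y) (e u z) (u == y) => p q r s t h1 h2; lia.
case: (out u uz) => ->; rewrite ?(negPf vz) ?(negPf vy);
  move: (walks2 e u v) (e u v) (u == v) => p q r _ h2; lia.
Qed.

Local Open Scope ring_scope.

(** * Norms of cyclotomic integers *)

Lemma rat_sqr_int (q : rat) (m : int) : q ^+ 2 = m%:~R -> exists k : int, m = k ^+ 2.
Proof.
move=> qm.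
have dq0 : denq q != 0 by rewrite denq_eq0.
have e : numq q ^+ 2 = m * denq q ^+ 2.
  apply: (@intr_inj rat); rewrite [RHS]rmorphM !rmorphXn /= -qm -exprMn.
  by rewrite -{2}[q]divq_num_den mulfVK // intr_eq0.
exists (numq q); suff d1 : `|denq q|%N = 1%N.
  by rewrite e -[denq q]absz_denq d1 expr1n mulr1.
have := coprime_num_den q; rewrite /coprime => /eqP <-.
apply/esym/gcdn_idPr; rewrite -(@dvdn_pexp2r _ _ 2) // -!abszX e abszM.
exact: dvdn_mull.
Qed.

(** The product of -3 - 4 z over the primitive i-th roots of unity z. *)
Definition cyclotomic_norm (i : nat) : rat :=
  4 ^+ totient i * (map_poly intr 'Phi_i).[- (3 / 4)].

Lemma det_scalar_sub (R : comNzRingType) n (C : 'M[R]_n) a :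
  \det (a%:M - C) = (char_poly C).[a].
Proof.
rewrite -horner_evalE /char_poly -det_map_mx; congr (\det _).
apply/matrixP => i j; rewrite !mxE /= /horner_eval !hornerE.
by rewrite hornerMn hornerX.
Qed.

(** The norm from Q(z) to Q is multiplicative and maps -3 - 4z to [cyclotomic_norm i]; q is the norm
    of g(z)/s. *)
Lemma cyclotomic_norm_sqr i (z : algC) (g : {poly rat}) (s : rat) :
    i.-primitive_root z ->
    (map_poly ratr g).[z] ^+ 2 = ratr s ^+ 2 * (- 3 - 4 * z) -> s != 0 ->
  exists q : rat, cyclotomic_norm i = q ^+ 2.
Proof.
move=> zi gz s0; pose p : {poly rat} := map_poly intr 'Phi_i.
have pC : map_poly ratr p = minCpoly z.
  rewrite (minCpoly_cyclotomic zi) -(Cintr_Cyclotomic zi) -map_poly_comp.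
  by apply: eq_map_poly => c /=; rewrite ratr_int.
have p_monic : p \is monic by rewrite monic_map // Cyclotomic_monic.
(* g^2 = s^2 (-3 - 4X) modulo 'Phi_i: evaluate at the companion matrix C of
   'Phi_i and take determinants. *)
pose h := g ^+ 2 - s ^+ 2 *: ((- 3)%:P - 4 *: 'X).
have ph : p %| h.
  have [p' [p'z _] p'P] := minCpolyP z.
  have -> : p = p'.
    apply: (map_inj_poly (fmorph_inj (ratr : {rmorphism rat -> algC})) (rmorph0 _)).
    by rewrite pC.
  rewrite -p'P /root /h rmorphB rmorphXn /= map_polyZ rmorphXn /= rmorphB /=.
  rewrite map_polyZ /= map_polyX map_polyC /= rmorphN !ratr_nat !hornerE gz.
  by apply/eqP; ring.
have sp : size p = (totient i).+1.
  by rewrite /p size_map_inj_poly ?size_Cyclotomic //; exact: intr_inj.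
(* A successor as size makes the matrices a ring. *)
have [m tm] : exists m, totient i = m.+1.
  by exists (totient i).-1; rewrite prednK // totient_gt0 (prim_order_gt0 zi).
have [C Cp] : exists C : 'M[rat]_m.+1, char_poly C = p.
  have := companionmxK p_monic; move: (companionmx p).
  by rewrite sp tm /= => C ?; exists C.
have hC : horner_mx C h = 0.
  by move: ph => /dvdpP[r ->]; rewrite rmorphM /= -Cp Cayley_Hamilton mulr0.
have : horner_mx C g ^+ 2 = s ^+ 2 *: (4 *: ((- (3 / 4))%:M - C)).
  apply/eqP; rewrite -subr_eq0 -[X in _ == X]hC /h rmorphB rmorphXn /=.
  apply/eqP; congr (_ - _).
  rewrite horner_mxZ rmorphB /= horner_mxZ horner_mx_C horner_mx_X; congr (_ *: _).
  by rewrite scalerBr scale_scalar_mx; congr (_ - _).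
move=> /(congr1 determinant); rewrite expr2 -mulmxE det_mulmx !detZ det_scalar_sub Cp.
move: (\det (horner_mx C g)) => D e; exists (D / s ^+ m.+1).
rewrite expr_div_n expr2 e /cyclotomic_norm tm -/p -!exprM [(2 * _)%N]mulnC.
by rewrite [RHS]mulrC mulKf // expf_neq0.
Qed.

(** Evaluate at -3/4 the factorisation of X^n - 1 into the 'Phi_d with d | n; the totients of these
    d sum to n. *)
Lemma prod_cyclotomic_norm n : (0 < n)%N ->
  \prod_(d <- divisors n) cyclotomic_norm d = (- 3) ^+ n - 4 ^+ n.
Proof.
move=> n0; rewrite big_split /= -horner_prod -rmorph_prod prod_Cyclotomic //.
rewrite rmorphB rmorphXn /= map_polyX rmorph1 !hornerE -expr_sum.
have -> : (\sum_(d <- divisors n) totient d)%N = n.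
  rewrite -[RHS]sum_totient_dvd -(big_mkord (fun d => d %| n)%N) -[RHS]big_filter.
  apply: perm_big.
  apply: uniq_perm; rewrite ?divisors_uniq ?filter_uniq ?iota_uniq // => d.
  rewrite -dvdn_divisors // mem_filter mem_index_iota ltnS leq0n /=.
  by case: (boolP (d %| n)%N) => //= /dvdn_leq ->.
by rewrite mulrBr mulr1 -exprMn; congr (_ ^+ _ - _).
Qed.

(* %Z denotes int_scope here. *)
Local Delimit Scope Z_scope with zZ.

(** * Computing the norms up to index 58 with binary integers *)

Definition pow_diff (n : nat) : Z := (Z.pow (-3) (Z.of_nat n) - Z.pow 4 (Z.of_nat n))%zZ.

Definition prodZ (s : seq Z) : Z := foldr Z.mul 1%zZ s.

Definition proper_divisors n := [seq d <- divisors n | d != n].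

(** Solves prod_cyclotomic_norm recursively for the norm of index n; entry 0 is junk. *)
Fixpoint norm_table (n : nat) : seq Z :=
  if n is m.+1 then
    let t := norm_table m in
    rcons t (pow_diff n / prodZ [seq nth 1%zZ t d | d <- proper_divisors n])%zZ
  else [:: 1%zZ].

(** [Z.sqrt] is 0 on negative numbers, which are thus rightly rejected. *)
Definition is_squareZ (z : Z) : bool := (Z.sqrt z * Z.sqrt z =? z)%zZ.

Definition table58 := Eval vm_compute in norm_table 58.

(** Multiplying back certifies the division made in the table, and P <> 0 makes the entry the only
    solution. The norms of index 2 and 4 are the squares 1 and 25. *)
Definition norm_tableP n : bool :=
  let P := prodZ [seq nth 1%zZ table58 d | d <- proper_divisors n] in
  let z := nth 1%zZ table58 n in
  [&& (z * P =? pow_diff n)%zZ, ~~ (P =? 0)%zZ & (n \in [:: 2; 4]%N) || ~~ is_squareZ z].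

Lemma norm_table_correct : all norm_tableP (iota 1 58).
Proof. by vm_compute. Qed.

Definition ZtoQ (z : Z) : rat := (int_of_Z z)%:~R.

Lemma ZtoQM (x y : Z) : ZtoQ (x * y)%zZ = ZtoQ x * ZtoQ y.
Proof. by rewrite /ZtoQ -intrM -rmorphM. Qed.

Lemma ZtoQ_prod (I : Type) (r : seq I) (f : I -> Z) :
  ZtoQ (prodZ [seq f i | i <- r]) = \prod_(i <- r) ZtoQ (f i).
Proof.
elim: r => [|i r IH]; first by rewrite big_nil.
by rewrite big_cons /= ZtoQM IH.
Qed.

Lemma ZtoQ_pow_diff n : ZtoQ (pow_diff n) = (- 3) ^+ n - 4 ^+ n.
Proof.
have pw (a : Z) k : ZtoQ (Z.pow a (Z.of_nat k)) = ZtoQ a ^+ k.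
  elim: k => [|k IH] //; rewrite Nat2Z.inj_succ Z.pow_succ_r ?ZtoQM ?IH ?exprS //.
  exact: Nat2Z.is_nonneg.
by rewrite /ZtoQ /pow_diff rmorphB intrB -!/(ZtoQ _) !pw.
Qed.

(** Strong induction: norms and table entries satisfy the same products over divisors, and the
    nonzero product over proper divisors cancels. *)
Lemma cyclotomic_normE n : (0 < n < 59)%N -> cyclotomic_norm n = ZtoQ (nth 1%zZ table58 n).
Proof.
elim/ltn_ind: n => n IH /andP[n0 n58].
have /(allP norm_table_correct) /and3P[/Z.eqb_eq e P0 _] : n \in iota 1 58.
  by rewrite mem_iota n0.
have := prod_cyclotomic_norm n0; rewrite -ZtoQ_pow_diff -e ZtoQM ZtoQ_prod.
rewrite (bigD1_seq n) ?divisors_uniq ?divisors_id //=.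
rewrite -big_filter -/(proper_divisors n).
have -> : \prod_(d <- proper_divisors n) cyclotomic_norm d =
          \prod_(d <- proper_divisors n) ZtoQ (nth 1%zZ table58 d).
  apply: eq_big_seq => d; rewrite mem_filter -dvdn_divisors // => /andP[dn d_n].
  have dltn : (d < n)%N by rewrite ltn_neqAle dn dvdn_leq.
  by apply: IH => //; rewrite (dvdn_gt0 n0 d_n) (ltn_trans dltn).
apply: mulIf; rewrite -ZtoQ_prod /ZtoQ intr_eq0.
apply: contra P0 => /eqP h; apply/Z.eqb_eq.
by rewrite -[LHS]int_of_ZK h.
Qed.

Lemma cyclotomic_norm_nonsquare n (q : rat) :
  (0 < n < 59)%N -> n != 2 -> n != 4 -> cyclotomic_norm n <> q ^+ 2.
Proof.
move=> n58 n2 n4; rewrite cyclotomic_normE // => /esym/rat_sqr_int[k e].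
have /(allP norm_table_correct) /and3P[_ _] : n \in iota 1 58.
  by rewrite mem_iota.
rewrite !inE (negPf n2) (negPf n4) /=; apply/negP; rewrite negbK.
rewrite -[nth _ _ _]int_of_ZK e rmorphXn /= expr2 /is_squareZ.
move: (Z_of_int k) => x; rewrite -[x * x]/(x * x)%zZ.
by apply/Z.eqb_eq; rewrite -(Z.abs_square x) Z.sqrt_square //; exact: Z.abs_nonneg.
Qed.

(** * Traces *)

Local Notation J := (const_mx 1).

(** In the rank factorisation E = C R, idempotency forces R C = 1, and the trace is cyclic. *)
Lemma mxtrace_idem (F : fieldType) n (E : 'M[F]_n) : E *m E = E -> \tr E = (\rank E)%:R.
Proof.
move=> EE; rewrite -[in \tr E](mulmx_base E) mxtrace_mulC.
suff -> : row_base E *m col_base E = 1%:M by rewrite mxtrace1.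
have /row_fullP[C] := col_base_full E; have /row_freeP[D] := row_base_free E.
move: C D (mulmx_base E); move: (\rank E) (col_base E) (row_base E).
move=> r c b C D cb bD Cc; move: EE; rewrite -cb => EE.
have := congr1 (fun M => C *m M *m D) EE.
by rewrite -!mulmxA bD !mulmx1 !mulmxA Cc !mul1mx.
Qed.

(** X divided by a square root of w is an involution of the image of E, so its
    trace is the difference of the dimensions of its two eigenspaces. *)
Lemma mxtrace_sqr_idem n (X E : 'M[algC]_n) (w : algC) :
    E *m E = E -> X *m E = X -> E *m X = X -> X *m X = w *: E -> w != 0 ->
  exists k : int, (\tr X) ^+ 2 = k%:~R ^+ 2 * w.
Proof.
move=> EE XE EX XX w0; pose b := sqrtC w.
have bb : b ^+ 2 = w by rewrite sqrtCK.
have b0 : b != 0 by rewrite sqrtC_eq0.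
pose U := b^-1 *: X.
have UU : U *m U = E.
  by rewrite -scalemxAl -scalemxAr XX !scalerA -bb (_ : _ * _ = 1) ?scale1r //; field.
have UE : U *m E = U by rewrite -scalemxAl XE.
have EU : E *m U = U by rewrite -scalemxAr EX.
(* The projection on the eigenspace of U for 1 inside the image of E, so that U = 2Q - E. *)
pose Q := 2^-1 *: (E + U).
have QQ : Q *m Q = Q.
  rewrite -scalemxAl -scalemxAr mulmxDl !mulmxDr EE UU UE EU.
  rewrite [U + E]addrC -mulr2n -scaler_nat !scalerA; congr (_ *: _).
  by field.
have tU : \tr X = b * (2 * (\rank Q)%:R - (\rank E)%:R).
  rewrite -!mxtrace_idem // /Q linearZ /= linearD /= /U [\tr (b^-1 *: X)]linearZ /=.
  by field; rewrite b0.
exists (2 * (\rank Q)%:Z - (\rank E)%:Z).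
by rewrite tU exprMn bb mulrC rmorphB rmorphM.
Qed.

Lemma mulJJ n : J * J = n.+1%:R *: J :> 'M[algC]_n.+1.
Proof.
apply/matrixP => i j; rewrite !mxE.
rewrite (eq_bigr (fun=> 1)) => [|k _]; last by rewrite !mxE mulr1.
by rewrite sumr_const card_ord mulr1.
Qed.

(** Here Y = B E with E the projection on the fixed vectors of P; the constant c is
    forced by Y J = 15 J.  Removing the eigenvalue 15 on the all-one vector leaves
    X with X^2 = - c F, whose real trace can only be 0. *)
Lemma principal_trace n (Y E : 'M[algC]_n.+1) :
    let c := 4 * n.+1%:R - 225 in
    E * E = E -> Y * E = Y -> E * Y = Y -> J * E = J -> E * J = J ->
    Y * J = 15 *: J -> J * Y = 15 *: J -> Y * Y = 4 *: J - c *: E ->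
    0 < c -> \tr Y \is Num.real ->
  \tr Y = 15.
Proof.
move=> c EE YE EY JE EJ YJ JY YY c_gt0 tr_real.
have N0 : n.+1%:R != 0 :> algC by rewrite pnatr_eq0.
move: (mulJJ n) => JJ; have trJ : \tr (J : 'M[algC]_n.+1) = n.+1%:R.
  rewrite /mxtrace (eq_bigr (fun=> 1)) => [|k _]; last by rewrite mxE.
  by rewrite sumr_const card_ord.
(* From here on J is an opaque K, subject only to the relations moved along with it. *)
move: (J) JE EJ YJ JY YY JJ trJ => K KE EK YK KY YY KK trK.
move: n.+1%:R @c c_gt0 N0 YY KK trK => N c c_gt0 N0 YY KK trK.
pose F := E - N^-1 *: K; pose X := Y - (15 / N) *: K.
have FF : F * F = F.
  rewrite /F !(mulrBl, mulrBr) -!(scalerAl, scalerAr) EE KE EK KK.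
  by apply/matrixP => i j; rewrite !mxE; field.
have XF : X * F = X.
  rewrite /F /X !(mulrBl, mulrBr) -!(scalerAl, scalerAr) YE KE YK KK.
  by apply/matrixP => i j; rewrite !mxE; field.
have FX : F * X = X.
  rewrite /F /X !(mulrBl, mulrBr) -!(scalerAl, scalerAr) EY EK KY KK.
  by apply/matrixP => i j; rewrite !mxE; field.
have XX : X * X = - c *: F.
  rewrite /F /X !(mulrBl, mulrBr) -!(scalerAl, scalerAr) YY YK KY KK.
  by apply/matrixP => i j; rewrite !mxE /c; field.
have c0 : - c != 0 by rewrite oppr_eq0 gt_eqF.
have [k trX] := mxtrace_sqr_idem FF XF FX XX c0.
have tX : \tr X = \tr Y - 15 by rewrite /X linearB linearZ /= trK divfK.
suff /eqP : \tr X = 0 by rewrite tX subr_eq0 => /eqP.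
have Xreal : \tr X \is Num.real by rewrite tX rpredB ?rpred_nat.
apply/eqP; rewrite -sqrf_eq0 eq_le real_exprn_even_ge0 // andbT.
rewrite trX mulrN oppr_le0; apply: mulr_ge0; last exact: ltW.
by rewrite real_exprn_even_ge0 // realz.
Qed.

Lemma sqr_double_add1 n (A P : 'M[algC]_n.+1) : A * A + A + 1 + P = J ->
  (A *+ 2 + 1) * (A *+ 2 + 1) = 4 *: J - 3 *: 1 - 4 *: P.
Proof.
move=> <-; rewrite -expr2 sqrrD1 exprMn_n expr2 -mulrnA; move: (A * A) => A2.
by apply/matrixP => i j; rewrite !(mulmxnE, mxE); ring.
Qed.

(** This is the case P = 0: [principal_trace] applies to Y = 2A + 1 and E = 1, with c = 4 * 57 - 225
    = 3. Its value 15 contradicts tr Y >= 57. *)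
Lemma no_moore (A : 'M[algC]_57) :
  A * A + A + 1 = J -> A * J = 7 *: J -> 0 <= \tr A -> False.
Proof.
move=> AA AJ trA; pose Y : 'M[algC]_57 := A *+ 2 + 1.
have YY : Y * Y = 4 *: J - 3%:A.
  by rewrite (@sqr_double_add1 56 A 0) ?addr0 // scaler0 subr0.
have JA : J * A = 7 *: J.
  rewrite -[RHS]AJ -AA !(mulrDl, mulrDr) mulr1 mul1r.
  by rewrite mulrA.
have tY : \tr Y = 15.
  apply: (@principal_trace 56 Y 1); rewrite ?mulr1 ?mul1r ?YY //.
  - by rewrite /Y mulrDl mul1r mulrnAl AJ; apply/matrixP => i j; rewrite !mxE; ring.
  - by rewrite /Y mulrDr mulr1 mulrnAr JA; apply/matrixP => i j; rewrite !mxE; ring.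
  - by congr (_ - _ *: _); ring.
  - by rewrite (_ : _ - _ = 3) //; ring.
  - by rewrite /Y raddfD raddfMn /= mxtrace1 rpredD ?rpredMn ?rpred_nat ?ger0_real.
move: tY; rewrite /Y raddfD raddfMn /= mxtrace1 => tY.
have : (57%:R : algC) <= 15 by rewrite -tY lerDr mulrn_wge0.
by rewrite ler_nat.
Qed.

(** * Spectral projections of matrices of finite order *)

Lemma mulr_sum_expr_unity (R : pzRingType) (W : R) L : W ^+ L = 1 ->
  W * (\sum_(j < L) W ^+ j) = \sum_(j < L) W ^+ j.
Proof.
move=> WL; apply/eqP; rewrite -subr_eq0 -{2}[\sum_(j < L) _]mul1r -mulrBl.
by rewrite -subrX1 WL subrr.
Qed.

(** The projection on the fixed vectors of W, provided W^L = 1. *)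
Definition spectral_proj n L (W : 'M[algC]_n.+1) := L%:R^-1 *: \sum_(j < L) W ^+ j.

Lemma mul_spectral_proj n L (W : 'M[algC]_n.+1) : W ^+ L = 1 ->
  W * spectral_proj L W = spectral_proj L W.
Proof. by move=> WL; rewrite -scalerAr mulr_sum_expr_unity. Qed.

Lemma spectral_proj_idem n L (W : 'M[algC]_n.+1) : (0 < L)%N -> W ^+ L = 1 ->
  spectral_proj L W * spectral_proj L W = spectral_proj L W.
Proof.
move=> L0 WL; rewrite {1}/spectral_proj -scalerAl mulr_suml.
have WjE j : W ^+ j * spectral_proj L W = spectral_proj L W.
  by elim: j => [|j IH]; rewrite ?mul1r // exprS -mulrA IH mul_spectral_proj.
under eq_bigr => j _ do rewrite WjE.
by rewrite sumr_const card_ord -scaler_nat scalerA mulVf ?scale1r // pnatr_eq0 -lt0n.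
Qed.

Lemma comm_spectral_proj n L (A W : 'M[algC]_n.+1) :
  A * W = W * A -> A * spectral_proj L W = spectral_proj L W * A.
Proof.
move=> AW; rewrite -scalerAl -scalerAr; congr (_ *: _).
by apply/commr_sum => j _; exact/commrX.
Qed.

(** Along a cycle of s the entries of a nonzero column of E get multiplied by z at each step, so z^l
    = 1 for the length l <= n of a cycle. *)
Lemma perm_eigen_order n (s : 'S_n) (z : algC) (E : 'M[algC]_n) i :
  perm_mx s *m E = z *: E -> E != 0 -> i.-primitive_root z -> (i <= n)%N.
Proof.
move=> sE /matrix0Pn[u [v Euv]] zi.
have E1 x : E (s x) v = z * E x v by have /matrixP/(_ x v) := sE; rewrite -row_permE !mxE.
have El l : E (iter l s u) v = z ^+ l * E u v.
  by elim: l => [|l IH]; rewrite ?mul1r //= E1 IH exprS mulrA.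
have := El #|porbit s u|; rewrite iter_porbit -[LHS]mul1r => /(mulIf Euv)/esym/eqP.
rewrite -(prim_order_dvd zi) => /dvdn_leq i_le.
apply: leq_trans (i_le _) _; last by rewrite -[leqRHS]card_ord max_card.
by apply/card_gt0P; exists u; exact: porbit_id.
Qed.

Lemma trace_mul_spectral_proj n L (B Q : 'M[algC]_n.+1) z :
  \tr (B * spectral_proj L (z *: Q)) =
  L%:R^-1 * \sum_(j < L) z ^+ j * \tr (B * Q ^+ j).
Proof.
rewrite -scalerAr linearZ /=; congr (_ * _); rewrite mulr_sumr raddf_sum /=.
by apply: eq_bigr => j _; rewrite exprZn -scalerAr linearZ.
Qed.

(** A vector fixed by z P^-1 is an eigenvector of P for z. *)
Lemma mul_spectral_proj_inv n L (P Q : 'M[algC]_n.+1) z :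
    P * Q = 1 -> Q ^+ L = 1 -> z ^+ L = 1 ->
  P * spectral_proj L (z *: Q) = z *: spectral_proj L (z *: Q).
Proof.
move=> PQ QL zL; rewrite -{1}mul_spectral_proj ?exprZn ?zL ?QL ?scale1r //.
by rewrite -scalerAl -scalerAr mulrA PQ mul1r.
Qed.

(** On the eigenspace of P for z the matrix J vanishes, since z <> 1, and B^2 is the scalar -3 - 4z;
    [mxtrace_sqr_idem] then gives the trace. The factor L clears the denominator of the
    projection. *)
Lemma trace_sum_sqr n L (A P Q : 'M[algC]_n.+1) z :
    let B := A *+ 2 + 1 in
    A * A + A + 1 + P = J -> A * Q = Q * A -> P * Q = 1 -> J * Q = J ->
    (0 < L)%N -> Q ^+ L = 1 -> z ^+ L = 1 -> z != 1 ->
  exists k : int, (\sum_(j < L) z ^+ j * \tr (B * Q ^+ j)) ^+ 2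
                    = (L%:R * k%:~R) ^+ 2 * (- 3 - 4 * z).
Proof.
move=> B AA AQ PQ JQ L0 QL zL z1.
have WL : (z *: Q) ^+ L = 1 by rewrite exprZn zL QL scale1r.
pose E := spectral_proj L (z *: Q); pose Y := B * E.
have EE : E * E = E by exact: spectral_proj_idem.
have BE : B * E = E * B.
  apply: comm_spectral_proj; rewrite /B mulrDl mulrDr mul1r mulr1.
  by rewrite -scalerAl -scalerAr mulrnAl mulrnAr AQ.
have JE : J * E = 0.
  have : (1 - z) *: (J * E) = 0.
    have WE : (z *: Q) * E = E := mul_spectral_proj WL.
    rewrite scalerBl scale1r -{1}WE mulrA -(scalerAr z J Q) JQ.
    by rewrite -scalerAl subrr.
  by move/eqP; rewrite scaler_eq0 subr_eq0 eq_sym (negPf z1) => /eqP.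
have PE : P * E = z *: E by exact: mul_spectral_proj_inv.
have trE : \tr (B * E) = L%:R^-1 * \sum_(j < L) z ^+ j * \tr (B * Q ^+ j).
  exact: trace_mul_spectral_proj.
clearbody E.
have YE : Y * E = Y by rewrite /Y -mulrA EE.
have EY : E * Y = Y by rewrite /Y mulrA -BE -mulrA EE.
have YY : Y * Y = (- 3 - 4 * z) *: E.
  rewrite {2}/Y BE mulrA YE /Y -mulrA -BE mulrA (sqr_double_add1 AA).
  rewrite !mulrBl -!scalerAl JE PE mul1r scaler0 sub0r.
  by rewrite scalerBl scaleNr scalerA.
(* The number -3/4 does not lie on the unit circle. *)
have w0 : - 3 - 4 * z != 0.
  apply/eqP => w0; have zE : z = - (3 / 4).
    have e : 4 * z = - 3 by rewrite -[LHS]addr0 -w0; ring.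
    by apply: (@mulfI _ 4); rewrite ?pnatr_eq0 // e; field.
  have : `|z| ^+ L = 1 by rewrite -normrX zL normr1.
  move/eqP; rewrite pexpr_eq1 // zE normrN ger0_norm ?divr_ge0 ?ler0n //.
  rewrite -(inj_eq (mulfI (_ : 4 != 0))) ?pnatr_eq0 //.
  by rewrite mulrCA divff ?pnatr_eq0 // !mulr1 eqr_nat.
have [k trY] := mxtrace_sqr_idem EE YE EY YY w0.
exists k; rewrite exprMn -mulrA -trY /Y trE exprMn mulrA -exprMn mulfV.
  by rewrite expr1n mul1r.
by rewrite pnatr_eq0 -lt0n.
Qed.

(** The case z = 1: on the fixed vectors of P the square of B is 4J - 7, and 7 = 4 * 58 - 225 as
    [principal_trace] requires. *)
Lemma trace_sum_one L (A P Q : 'M[algC]_58) :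
    let B := A *+ 2 + 1 in
    A * A + A + 1 + P = J -> A * Q = Q * A -> P * Q = 1 -> J * Q = J -> Q * J = J ->
    A * J = 7 *: J -> J * A = 7 *: J ->
    (0 < L)%N -> Q ^+ L = 1 -> (forall j, \tr (B * Q ^+ j) \is Num.real) ->
  \sum_(j < L) \tr (B * Q ^+ j) = 15 * L%:R.
Proof.
move=> B AA AQ PQ JQ QJ AJ JA L0 QL Breal.
have L0' : L%:R != 0 :> algC by rewrite pnatr_eq0 -lt0n.
pose E := spectral_proj L Q.
have EE : E * E = E by exact: spectral_proj_idem.
have BE : B * E = E * B.
  apply: comm_spectral_proj; rewrite /B mulrDl mulrDr mul1r mulr1.
  by rewrite mulrnAl mulrnAr AQ.
have QE : Q * E = E by exact: mul_spectral_proj.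
have trE : \tr (B * E) = L%:R^-1 * \sum_(j < L) \tr (B * Q ^+ j).
  rewrite /E -[Q]scale1r trace_mul_spectral_proj; congr (_ * _).
  by apply: eq_bigr => j _; rewrite scale1r expr1n mul1r.
have JE : J * E = J.
  rewrite /E -scalerAr mulr_sumr (eq_bigr (fun=> J)) => [|j _].
    by rewrite sumr_const card_ord -scaler_nat scalerA mulVf ?scale1r.
  by elim: (j : nat) => [|k IH]; rewrite ?mulr1 // exprS mulrA JQ.
have EJ : E * J = J.
  rewrite /E -scalerAl mulr_suml (eq_bigr (fun=> J)) => [|j _].
    by rewrite sumr_const card_ord -scaler_nat scalerA mulVf ?scale1r.
  by elim: (j : nat) => [|k IH]; rewrite ?mul1r // exprSr -mulrA QJ.
have PE : P * E = E by rewrite -{1}QE mulrA PQ mul1r.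
clearbody E.
have BJ : B * J = 15 *: J.
  by rewrite /B mulrDl mul1r mulrnAl AJ; apply/matrixP => i j; rewrite !(mulmxnE, mxE); ring.
have JB : J * B = 15 *: J.
  by rewrite /B mulrDr mulr1 mulrnAr JA; apply/matrixP => i j; rewrite !(mulmxnE, mxE); ring.
have : \tr (B * E) = 15.
  apply: (@principal_trace 57 _ E) => //.
  - by rewrite -mulrA EE.
  - by rewrite mulrA -BE -mulrA EE.
  - by rewrite -mulrA EJ BJ.
  - by rewrite mulrA JB -scalerAl JE.
  - rewrite {2}BE mulrA -[_ * E * E]mulrA EE -mulrA -BE mulrA (sqr_double_add1 AA).
    rewrite !mulrBl -!scalerAl JE PE mul1r.
    by apply/matrixP => i j; rewrite !mxE; ring.
  - by rewrite (_ : _ - _ = 7) //; ring.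
  - by rewrite trE rpredM ?rpredV ?rpred_nat ?rpred_sum.
by rewrite trE => <-; rewrite mulrC mulVKf.
Qed.

(** The quotient D of X^(4M) - 1 by X^4 - 1 divides g; as D = 1 + X^4 + X^8 + ...,
    the cofactor consists of the first four coefficients of g. *)
Lemma periodic_factor M (c : nat -> algC) :
    let g := \poly_(j < 4 * M) c j in (0 < M)%N ->
    (forall z, z ^+ (4 * M) = 1 -> z ^+ 4 != 1 -> g.[z] = 0) ->
  forall z, z ^+ 4 = 1 -> g.[z] = M%:R * \sum_(j < 4) c j * z ^+ j.
Proof.
move=> g M0 gz0; have L0 : (0 < 4 * M)%N by rewrite muln_gt0.
pose D : {poly algC} := \sum_(k < M) 'X^4 ^+ k.
have LD : 'X^(4 * M) - 1 = ('X^4 - 1) * D by rewrite /D -subrX1 -exprM.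
have X4 : ('X^4 - 1 : {poly algC}) != 0 by rewrite monic_neq0 // monicXnsubC.
(* After multiplication by X^4 - 1 the divisor is X^(4M) - 1, whose roots are simple and are roots
   of X^4 - 1 or of g. *)
have /dvdpP[q gq] : D %| g.
  rewrite -(dvdp_mul2l _ _ X4) -LD.
  have [w wL] := C_prim_root_exists L0.
  rewrite -(factor_Xn_sub_1 wL) -(big_map (fun i => w ^+ i) predT (fun x => 'X - x%:P)).
  apply: uniq_roots_dvdp.
    apply/allP => _ /mapP[i _ ->].
    have wi : (w ^+ i) ^+ (4 * M) = 1 by rewrite exprAC (prim_expr_order wL) expr1n.
    rewrite /root hornerM !hornerE; have [w4|w4] := eqVneq ((w ^+ i) ^+ 4) 1.
      by rewrite w4 subrr mul0r.
    by rewrite (gz0 _ wi w4) mulr0.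
  rewrite uniq_rootsE map_inj_in_uniq ?iota_uniq // => i j.
  rewrite !mem_iota /= !add0n subn0 => iL jL /eqP.
  by rewrite (eq_prim_root_expr wL) !modn_small // => /eqP.
have LM : size D = (4 * M - 3)%N.
  have := congr1 (fun p : {poly algC} => size p) LD.
  rewrite size_XnsubC // size_monicM ?monicXnsubC //; first by rewrite size_XnsubC // => e; lia.
  apply/eqP => D0; have := monicXnsubC (1 : algC) L0.
  by rewrite LD D0 mulr0 monicE lead_coef0 eq_sym oner_eq0.
have q4 : (size q <= 4)%N.
  have [-> | q0] := eqVneq q 0; first by rewrite size_poly0.
  have D0 : D != 0 by rewrite -size_poly_gt0 LM; lia.
  have : (size g <= 4 * M)%N by exact: size_poly.
  rewrite gq size_mul // LM.
  by move: (size q) => m; clear -M0; lia.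
(* D is 1 modulo X^4. *)
have qc j : (j < 4)%N -> q`_j = c j.
  move=> j4; have gj : g`_j = c j by rewrite coef_poly ifT //; lia.
  rewrite -gj gq /D; case: (M) M0 => // M' _.
  rewrite big_ord_recl expr0 mulrDr mulr1 coefD.
  under eq_bigr => k _ do rewrite /= /bump add1n exprS.
  by rewrite -mulr_sumr mulrCA mulrC coefMXn j4 addr0.
move=> z z4; rewrite gq hornerM mulrC; congr (_ * _).
  rewrite /D horner_sum (eq_bigr (fun=> 1)) => [|k _]; first by rewrite sumr_const card_ord.
  by rewrite !hornerE z4 expr1n.
rewrite (horner_coef_wide _ q4); by apply: eq_bigr => j _; rewrite qc.
Qed.

(** * The regular case *)

Lemma mxtrace_nat n (A : 'M[algC]_n) :
  (forall i j, A i j \is a Num.nat) -> \tr A \is a Num.nat.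
Proof. by move=> An; apply: rpred_sum => i _. Qed.

Lemma no_regular (A : 'M[algC]_58) (o : 'S_58) :
    (forall i j, A i j \is a Num.nat) ->
    A * A + A + 1 + perm_mx o = J -> A * J = 7 *: J -> J * A = 7 *: J -> \tr A = 0 ->
  False.
Proof.
move=> An AA AJ JA trA.
pose P : 'M[algC]_58 := perm_mx o; pose Q : 'M[algC]_58 := perm_mx o^-1.
(* The factor 4 puts the fourth roots of unity among the L-th ones. *)
pose M := #[o]%g; pose L := (4 * M)%N; pose B := A *+ 2 + 1.
have M0 : (0 < M)%N by exact: order_gt0.
have L0 : (0 < L)%N by rewrite muln_gt0.
have PQ : P * Q = 1 by rewrite -mulmxE -perm_mxM mulgV perm_mx1.
have QP : Q * P = 1 by rewrite -mulmxE -perm_mxM mulVg perm_mx1.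
have QX j : Q ^+ j = perm_mx ((o^-1) ^+ j)%g.
  by elim: j => [|j IH]; rewrite ?perm_mx1 // exprS IH -mulmxE -perm_mxM -expgS.
have QL : Q ^+ L = 1 by rewrite QX /L mulnC expgM expgVn expg_order invg1 expg1n perm_mx1.
have JQ : J * Q = J by apply/matrixP => i j; rewrite -mulmxE -col_permE !mxE.
have QJ : Q * J = J by apply/matrixP => i j; rewrite -mulmxE -row_permE !mxE.
have AP : A * P = P * A.
  have : A * (A * A + A + 1 + P) = (A * A + A + 1 + P) * A by rewrite AA AJ JA.
  by rewrite !(mulrDl, mulrDr) mulr1 mul1r mulrA => /addrI.
have AQ : A * Q = Q * A by rewrite -[LHS]mul1r -QP -mulrA (mulrA P) -AP -!mulrA PQ mulr1.
have trn j : \tr (B * Q ^+ j) \is a Num.nat.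
  apply: mxtrace_nat => i k; rewrite -mulmxE mxE rpred_sum // => l _.
  by rewrite QX /B !(mulmxnE, mxE) rpredM ?rpred_nat // rpredD ?rpred_nat // rpredMn.
pose c j := Num.truncn (\tr (B * Q ^+ j)).
have cE j : \tr (B * Q ^+ j) = (c j)%:R by rewrite truncnK.
pose g : {poly algC} := \poly_(j < L) (c j)%:R.
have gE z : g.[z] = \sum_(j < L) z ^+ j * \tr (B * Q ^+ j).
  by rewrite horner_poly; apply: eq_bigr => j _; rewrite cE mulrC.
have gsqr z : z ^+ L = 1 -> z != 1 ->
    exists k : int, g.[z] ^+ 2 = (L%:R * k%:~R) ^+ 2 * (- 3 - 4 * z).
  by move=> zL z1; rewrite gE; have := trace_sum_sqr AA AQ PQ JQ L0 QL zL z1.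
have g0 z : z ^+ L = 1 -> z ^+ 4 != 1 -> g.[z] = 0.
  move=> zL z4; have [i zi iL] := prim_order_exists L0 zL.
  have z1 : z != 1 by apply: contraNneq z4 => ->; rewrite expr1n.
  (* If z is not an eigenvalue of P, the trace is zero; otherwise the order i of z is at most 58. *)
  have [E0|E0] := eqVneq (spectral_proj L (z *: Q)) 0.
    have := trace_mul_spectral_proj L B Q z; rewrite E0 mulr0 mxtrace0 -gE => /esym/eqP.
    by rewrite mulf_eq0 invr_eq0 pnatr_eq0 (gtn_eqF L0) => /eqP.
  have i58 : (i <= 58)%N.
    exact: perm_eigen_order (mul_spectral_proj_inv PQ QL zL) E0 zi.
  have i_ndvd4 : ~~ (i %| 4)%N by rewrite (prim_order_dvd zi).
  have [k gk] := gsqr z zL z1.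
  apply/eqP; apply: contraT => gz0.
  pose gQ : {poly rat} := \poly_(j < L) (c j)%:R.
  have gQE : map_poly ratr gQ = g.
    apply/polyP => j; rewrite coef_map !coef_poly.
    by case: ifP => _; rewrite /= (ratr_nat, rmorph0).
  pose s : rat := L%:R * k%:~R.
  have s0 : s != 0.
    apply: contraNneq gz0 => s0; rewrite -sqrf_eq0 gk.
    have -> : L%:R * k%:~R = ratr s :> algC by rewrite rmorphM /= ratr_nat ratr_int.
    by rewrite s0 rmorph0 expr0n mul0r.
  have [q] : exists q : rat, cyclotomic_norm i = q ^+ 2.
    apply: (@cyclotomic_norm_sqr i z gQ s zi _ s0).
    by rewrite gQE gk rmorphM /= ratr_nat ratr_int.
  case/cyclotomic_norm_nonsquare.
  - by rewrite (prim_order_gt0 zi) ltnS.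
  - by apply: contraNneq i_ndvd4 => ->.
  - by apply: contraNneq i_ndvd4 => ->.
have gM z : z ^+ 4 = 1 -> g.[z] = M%:R * \sum_(j < 4) (c j)%:R * z ^+ j.
  exact: periodic_factor.
have Breal j : \tr (B * Q ^+ j) \is Num.real by rewrite cE realn.
have M0' : M%:R != 0 :> algC by rewrite pnatr_eq0 -lt0n.
have c0 : c 0 = 58%N.
  apply/eqP; rewrite -(eqr_nat algC) -cE expr0 mulr1 /B raddfD raddfMn /= trA mxtrace1.
  by rewrite mul0rn add0r.
(* Here g(1) = 15 L, and L = 4M. *)
have c_sum : (c 0 + c 1 + c 2 + c 3 = 60)%N.
  apply/eqP; rewrite -(eqr_nat algC); apply/eqP.
  have := gM 1 (expr1n _ _); rewrite gE.
  under eq_bigr => j _ do rewrite expr1n mul1r.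
  rewrite (trace_sum_one AA AQ PQ JQ QJ AJ JA L0 QL Breal) /L natrM mulrA [in LHS]mulrC.
  move/(mulfI M0'); under eq_bigr => j _ do rewrite expr1n mulr1.
  by rewrite !big_ord_recr big_ord0 /= add0r -!natrD => <-; rewrite -natrM.
have i4 : 'i ^+ 4 = 1 :> algC by rewrite (exprM _ 2 2) sqrCi sqrrN expr1n.
have i1 : 'i != 1 :> algC.
  apply/eqP => i1; have := sqrCi algC; rewrite i1 expr1n => /eqP.
  by rewrite -subr_eq0 opprK -(natrD _ 1 1) pnatr_eq0.
have iL : 'i ^+ L = 1 :> algC by rewrite exprM i4 expr1n.
have [k] := gsqr 'i iL i1; rewrite (gM _ i4) /L natrM => gk.
pose x : int := (c 0)%:Z - (c 2)%:Z; pose y : int := (c 1)%:Z - (c 3)%:Z.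
have qi : \sum_(j < 4) (c j)%:R * 'i ^+ j = x%:~R + 'i * y%:~R :> algC.
  rewrite !big_ord_recr big_ord0 /= add0r expr0 expr1 (exprD _ 2 1) sqrCi /x /y !rmorphB /=.
  by rewrite expr1; ring.
(* The factor 16 is (L/M)^2. The real part will read x^2 - y^2 = -48 k^2. *)
have sq : (x%:~R + 'i * y%:~R) ^+ 2 = 16 * k%:~R ^+ 2 * (-3 - 4 * 'i) :> algC.
  by apply: (mulfI (_ : M%:R ^+ 2 != 0)); rewrite ?expf_neq0 // -qi -exprMn gk; ring.
have := congr1 (fun u : algC => 'Re u) sq.
have -> : (x%:~R + 'i * y%:~R) ^+ 2 = (x ^+ 2 - y ^+ 2)%:~R + 'i * (2 * x * y)%:~R :> algC.
  by move: x y {qi sq} => x y; rewrite intrB !rmorphXn !intrM sqrrD exprMn sqrCi /=; ring.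
have -> : 16 * k%:~R ^+ 2 * (-3 - 4 * 'i) =
    (- 48 * k ^+ 2)%:~R + 'i * (- 64 * k ^+ 2)%:~R :> algC.
  by rewrite !(intrM, intrN); ring.
rewrite !Re_rect ?realz // => /intr_inj.
rewrite /x /y; move: (c 0) (c 1) (c 2) (c 3) c_sum c0 => a b d f sum a58 e.
have k_ge0 := sqr_ge0 k.
(* As c_1 + c_2 + c_3 = 2, x^2 - y^2 is at least 56^2 - 2^2 > 0. *)
have [d2 b2 f2] : [/\ (d <= 2)%N, (b <= 2)%N & (f <= 2)%N] by split; lia.
have b_sqr : (b%:Z - f%:Z) ^+ 2 <= 4 by nia.
have d_sqr : 56 ^+ 2 <= (a%:Z - d%:Z) ^+ 2 by nia.
lia.
Qed.

(** * The irregular case and the conclusion *)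

Lemma no_irregular (e : rel 'I_58) (o : 'I_58 -> 'I_58) z :
    outlier_system e o -> (forall u, u != z -> o u = z \/ o u = o z) ->
    (forall u, ~~ e u z) \/ (forall v, e (o z) v = e z v) ->
  False.
Proof.
move=> sys out src; have [row_sum moore] := merged_moore sys out src.
pose A : 'M[algC]_57 := \matrix_(i, j) (merged_arc e z (o z) i j)%:R.
apply: (@no_moore A).
- apply/matrixP => i j; rewrite !mxE.
  have /(congr1 (fun m => m%:R : algC)) := moore i j.
  rewrite !natrD natr_sum => h; rewrite -[RHS]h; congr (_ + _ + _).
  by apply: eq_bigr => k _; rewrite !mxE natrM.
- apply/matrixP => i j; rewrite !mxE mulr1.
  have /(congr1 (fun m => m%:R : algC)) := row_sum i; rewrite natr_sum => <-.
  by apply: eq_bigr => k _; rewrite !mxE mulr1.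
- by apply: sumr_ge0 => i _; rewrite mxE ler0n.
Qed.

Lemma no_outlier_system (e : rel 'I_58) (o : 'I_58 -> 'I_58) : ~ outlier_system e o.
Proof.
move=> sys; have card := card_ord 58.
have [d7|[z [out src]]] := indeg_dichotomy sys card; last exact: no_irregular sys out src.
have [deg H] := sys.
(* With all in-degrees 7, [indeg_count] leaves 58 - 1 - 7 - 49 = 1 for the fibre of o. *)
have o_fib v : (\sum_u (v == o u) = 1)%N.
  have := indeg_count v sys; rewrite card d7.
  rewrite (eq_bigr (fun w => 7 * e w v)%N) => [|w _]; last by rewrite d7.
  rewrite -big_distrr /= -/(indeg e v) d7.
  by move: (\sum_u _)%N => m; lia.
have o_inj : injective o.
  move=> u w ouw; apply/eqP; apply: contraT => uw.
  have := o_fib (o u); rewrite (bigD1 u) //= (bigD1 w) 1?eq_sym //= ouw eqxx; lia.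
pose A : 'M[algC]_58 := \matrix_(i, j) (e i j)%:R.
apply: (@no_regular A (perm o_inj)).
- by move=> i j; rewrite mxE rpred_nat.
- apply/matrixP => i j; rewrite !mxE permE.
  have /(congr1 (fun m => m%:R : algC)) := H i j.
  rewrite /reach2 /walks2 !natrD natr_sum => h; rewrite -[RHS]h.
  rewrite [j == _]eq_sym (eq_bigr (fun k => (e i k * e k j)%:R)) => [|k _].
    by ring.
  by rewrite !mxE natrM.
- apply/matrixP => i j; rewrite !mxE mulr1.
  have /(congr1 (fun m => m%:R : algC)) := deg i; rewrite natr_sum => <-.
  by apply: eq_bigr => k _; rewrite !mxE mulr1.
- apply/matrixP => i j; rewrite !mxE mulr1.
  have /(congr1 (fun m => m%:R : algC)) := d7 j; rewrite natr_sum => <-.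
  by apply: eq_bigr => k _; rewrite !mxE mul1r.
- rewrite /mxtrace big1 // => i _; rewrite mxE.
  by have [/negPf -> ] := outlier_simple i sys.
Qed.

Local Close Scope ring_scope.

Theorem theorem9 (T : finType) (e : rel T) : ~ excess_one_digraph 7 2 e.
Proof.
case=> geo [deg _] card.
have {}card : #|T| = 58%N.
  by rewrite card /moore_bound !big_nat_recl // big_geq.
have [o [deg7 H]] := exists_outlier geo deg card.
(* The vertices are numbered so that they can index matrices. *)
pose f (i : 'I_58) : T := enum_val (cast_ord (esym card) i).
have f_bij : bijective f.
  by apply: inj_card_bij; [move=> i j /enum_val_inj/cast_ord_inj | rewrite card card_ord].
have [g fK gK] := f_bij.
pose e' : rel 'I_58 := fun i j => e (f i) (f j).
apply: (@no_outlier_system e' (fun i => g (o (f i)))); split=> [i|i j].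
  by have := deg7 (f i); rewrite (reindex f) //; exists g.
have := H (f i) (f j); rewrite /reach2 /walks2 (reindex f) /=; last by exists g.
by rewrite (inj_eq (can_inj fK)) (can2_eq fK gK).
Qed.
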